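(* Let $G$ be a graph with $n\ge 2$ vertices, $m$ edges and degree sequence $d_1,\ldots,d_n$, with Laplacian eigenvalues $\mu_1\ge\mu_2\ge\cdots\ge\mu_{n-1}\ge\mu_n=0$. Let $\phi$ be a real number with $\mu_{n-1}\le\phi\le\mu_1$. Then $$\frac{2}{n}\Big|\,nZ_g(G)+2mn+(n-1)\phi^2-4m(m+\phi)\Big|^{\frac12}\ \le\ S_L(G).$$
   Context: Graphs are finite, simple and undirected. The Laplacian matrix is $L(G)=D(G)-A(G)$ (degree matrix minus adjacency matrix), and the Laplacian spread is $S_L(G)=\mu_1-\mu_{n-1}$. The first Zagreb index is $Z_g(G)=\sum_{i=1}^n d_i^2$. *)

(* Defs.v *)
From HB Require Import structures.
From mathcomp Require Import all_boot all_order all_algebra.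
From mathcomp Require Import reals.

Set Implicit Arguments.
Unset Strict Implicit.
Unset Printing Implicit Defensive.

Import Order.TTheory GRing.Theory Num.Theory.
Local Open Scope ring_scope.

Record sgraph (n : nat) := SGraph {
  adj :> rel 'I_n;
  adj_sym : symmetric adj;
  adj_irr : irreflexive adj
}.

Definition deg n (G : sgraph n) (i : 'I_n) : nat := #|[set j | G i j]|.

(* The edge {i, j} is counted once, as the ordered pair with i < j. *)
Definition num_edges n (G : sgraph n) : nat :=
  #|[set e : 'I_n * 'I_n | (e.1 < e.2)%N && G e.1 e.2]|.

Definition zagreb1 n (G : sgraph n) : nat := (\sum_(i < n) deg G i ^ 2)%N.

Definition degree_mx (R : realType) n (G : sgraph n) : 'M[R]_n :=
  diag_mx (\row_i (deg G i)%:R).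

Definition adjacency_mx (R : realType) n (G : sgraph n) : 'M[R]_n :=
  \matrix_(i, j) (G i j)%:R.

Definition laplacian (R : realType) n (G : sgraph n) : 'M[R]_n :=
  degree_mx R G - adjacency_mx R G.

(* mu lists the eigenvalues of A with algebraic multiplicity, in nonincreasing
   order. For symmetric A (such as a Laplacian) there is exactly one such mu,
   by the spectral theorem. *)
Definition ordered_spectrum (R : realType) n (A : 'M[R]_n) (mu : n.-tuple R) :
    Prop :=
  char_poly A = \prod_(x <- mu) ('X - x%:P) /\ sorted >=%R mu.

(* Indices are shifted by one: mu_k of the mathematical notation is mu`_(k - 1),
   so that this is mu_1 - mu_(n-1), meaningful for n >= 2. *)
Definition laplacian_spread (R : realType) n (mu : n.-tuple R) : R :=
  mu`_0 - mu`_(n - 2).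

(* Main.v *)
Require Import Defs.
From HB Require Import structures.
From mathcomp Require Import all_boot all_order all_algebra.
From mathcomp Require Import reals.
From mathcomp Require Import ring.

Set Implicit Arguments.
Unset Strict Implicit.
Unset Printing Implicit Defensive.

Import Order.TTheory GRing.Theory Num.Theory.
Local Open Scope ring_scope.

(** The radicand is a variance in disguise.  Adjoin phi to mu_1, ..., mu_(n-1):
this gives n numbers, all lying in the interval [mu_(n-1), mu_1].  Since
mu_n = 0, their sum is S = 2m + phi and the sum of their squares is
Q = Z_g + 2m + phi^2, and n Q - S^2 is exactly the expression under the root.
It is n^2 times the variance of the n numbers, so it is nonnegative
([scaled_variance_ge0]) and, by Popoviciu's inequality
([scaled_variance_le]), at most n^2 (mu_1 - mu_(n-1))^2 / 4.

The sums S and Q come from the traces of L and of L^2.  The first is a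
coefficient of the characteristic polynomial; for the second, the eigenvalues
of L^2 are the squares of those of L with the same multiplicities
([char_poly_sqr]), a purely polynomial fact that needs no diagonalization.
The smallest eigenvalue is 0 because the quadratic form of L is a sum of
squares ([laplacian_form]) and because L annihilates the constant vectors. *)

(** * Traces and the roots of the characteristic polynomial *)

Section RootsOfCharPoly.

Variables (R : comNzRingType) (n : nat).
Implicit Types (A : 'M[R]_n) (s : seq R).

(** Up to the sign (-1)^n, the matrix X + A is X - A with -X substituted
for X. *)
Lemma det_X_plus A s : size s = n ->
    char_poly A = \prod_(x <- s) ('X - x%:P) ->
  \det ('X%:M + map_mx polyC A) = \prod_(x <- s) ('X + x%:P).
Proof.
move=> size_s charA.
have -> : 'X%:M + map_mx polyC A
          = -1 *: map_mx (comp_poly (- 'X)) (char_poly_mx A).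
  apply/matrixP=> i j; rewrite !mxE rmorphB rmorphMn /= comp_polyX comp_polyC.
  by rewrite mulN1r opprB mulNrn opprK addrC.
rewrite detZ det_map_mx -/(char_poly A) charA rmorph_prod -size_s.
elim: s {charA size_s} => [|x s IHs]; first by rewrite !big_nil mulr1.
rewrite !big_cons -IHs /= rmorphB /= comp_polyX comp_polyC exprS; ring.
Qed.

(** Substituting X^2 for X in the characteristic polynomial of A^2 gives
det (X^2 - A^2) = det (X - A) det (X + A), whose factors are known. *)
Lemma char_poly_sqr A s : size s = n ->
    char_poly A = \prod_(x <- s) ('X - x%:P) ->
  char_poly (A *m A) = \prod_(x <- s) ('X - (x ^+ 2)%:P).
Proof.
move=> size_s charA.
suff comp_eq : char_poly (A *m A) \Po 'X^2
               = (\prod_(x <- s) ('X - (x ^+ 2)%:P)) \Po 'X^2.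
  apply/polyP=> i; move/(congr1 (fun p : {poly R} => p`_(i * 2))): comp_eq.
  by rewrite !coef_comp_poly_Xn // dvdn_mull // mulnK.
rewrite /char_poly -det_map_mx.
have -> : map_mx (comp_poly 'X^2) (char_poly_mx (A *m A))
          = char_poly_mx A *m ('X%:M + map_mx polyC A).
  rewrite /char_poly_mx mulmxDr !mulmxBl -scalar_mxM -scalar_mxC.
  rewrite addrA subrK -map_mxM; apply/matrixP=> i j.
  by rewrite !mxE rmorphB rmorphMn /= comp_polyX comp_polyC.
rewrite det_mulmx -/(char_poly A) (det_X_plus size_s charA) charA.
rewrite rmorph_prod -big_split; apply: eq_bigr => x _ /=.
rewrite rmorphB /= comp_polyX comp_polyC rmorphXn /=; ring.
Qed.

Lemma mxtrace_roots A s : (0 < n)%N -> size s = n ->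
  char_poly A = \prod_(x <- s) ('X - x%:P) -> \tr A = \sum_(x <- s) x.
Proof.
move=> n_gt0 size_s charA; apply: oppr_inj.
by rewrite -char_poly_trace // charA -size_s coefPn_prod_XsubC // size_s -lt0n.
Qed.

Lemma mxtrace_sqr_roots A s : (0 < n)%N -> size s = n ->
    char_poly A = \prod_(x <- s) ('X - x%:P) ->
  \tr (A *m A) = \sum_(x <- s) x ^+ 2.
Proof.
move=> n_gt0 size_s charA.
rewrite (@mxtrace_roots (A *m A) [seq x ^+ 2 | x <- s]) ?big_map ?size_map //.
exact: char_poly_sqr.
Qed.

End RootsOfCharPoly.

(** * The Laplacian matrix *)

Section Laplacian.

Variables (R : realType) (n : nat) (G : sgraph n).
Local Notation L := (laplacian R G).

Lemma deg_sum i : deg G i = (\sum_j G i j)%N.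
Proof. by rewrite /deg cardsE -sum1_card big_mkcond. Qed.

Lemma handshake : (\sum_i deg G i = 2 * num_edges G)%N.
Proof.
have edgesE : num_edges G = (\sum_(i < n) \sum_(j < n) ((i < j) && G i j))%N.
  rewrite /num_edges cardsE -sum1_card big_mkcond /=.
  by rewrite pair_bigA; apply: eq_bigr.
have edges_flip : num_edges G = (\sum_(i < n) \sum_(j < n) ((j < i) && G i j))%N.
  rewrite edgesE exchange_big; apply: eq_bigr => i _; apply: eq_bigr => j _.
  by rewrite adj_sym.
rewrite mul2n -addnn {1}edgesE edges_flip -big_split /=.
apply: eq_bigr => i _; rewrite deg_sum -big_split /=.
apply: eq_bigr => j _; case: ltngtP => //= [|eq_ij]; first by rewrite addn0.
by rewrite (val_inj eq_ij) adj_irr.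
Qed.

Lemma laplacianE i j : L i j = (deg G i)%:R *+ (i == j) - (G i j)%:R.
Proof. by rewrite !mxE. Qed.

Lemma sum_row_laplacian (f : 'I_n -> R) i :
  \sum_j L i j * f j = \sum_j (G i j)%:R * (f i - f j).
Proof.
rewrite (eq_bigr (fun j => (if j == i then (deg G i)%:R * f j else 0)
                           - (G i j)%:R * f j)) => [|j _]; last first.
  by rewrite laplacianE eq_sym mulrBl; case: ifP => _; rewrite ?mul0r.
rewrite sumrB -big_mkcond /=.
rewrite big_pred1_eq deg_sum natr_sum mulr_suml -sumrB.
by apply: eq_bigr => j _; rewrite mulrBr.
Qed.

Lemma laplacian_sym i j : L i j = L j i.
Proof. by rewrite !laplacianE adj_sym eq_sym; case: eqP => [->|]. Qed.

(** An edge ij contributes f i (f i - f j) in one orientation and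
f j (f j - f i) in the other, hence (f i - f j)^2 in total; the factor 2
appears because the right-hand side runs over ordered pairs. *)
Lemma laplacian_form (f : 'I_n -> R) :
  (\sum_i f i * \sum_j L i j * f j) *+ 2
  = \sum_i \sum_j (G i j)%:R * (f i - f j) ^+ 2.
Proof.
under eq_bigr do rewrite sum_row_laplacian mulr_sumr.
rewrite mulr2n {2}exchange_big -big_split; apply: eq_bigr => i _ /=.
rewrite -big_split; apply: eq_bigr => j _ /=.
by rewrite [G j i]adj_sym; ring.
Qed.

Lemma laplacian_form_ge0 (f : 'I_n -> R) :
  0 <= \sum_i f i * \sum_j L i j * f j.
Proof.
rewrite -(pmulrn_lge0 _ (ltn0Sn 1)) laplacian_form.
by do 2!apply: sumr_ge0 => ? _; rewrite mulr_ge0 ?ler0n ?sqr_ge0.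
Qed.

Lemma laplacian_eigenvalue_ge0 a : eigenvalue L a -> 0 <= a.
Proof.
case/eigenvalueP=> v vL v_neq0.
have rowL i : \sum_j L i j * v 0 j = a * v 0 i.
  move/rowP/(_ i): vL; rewrite !mxE => <-.
  by apply: eq_bigr => j _; rewrite laplacian_sym mulrC.
have := laplacian_form_ge0 (v 0).
under eq_bigr do rewrite rowL mulrCA -expr2.
have norm_gt0 : 0 < \sum_i v 0 i ^+ 2.
  case/rV0Pn: v_neq0 => i vi_neq0.
  rewrite (bigD1 i) //= ltr_wpDr ?exprn_even_gt0 //.
  by apply: sumr_ge0 => j _; exact: sqr_ge0.
by rewrite -mulr_sumr pmulr_lge0.
Qed.

Lemma laplacian_eigenvalue0 : (0 < n)%N -> eigenvalue L 0.
Proof.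
move=> n_gt0; apply/eigenvalueP; exists (const_mx 1).
  apply/rowP=> i; rewrite scale0r !mxE.
  rewrite (eq_bigr (fun j => L i j * 1)) => [|j _].
    by rewrite (sum_row_laplacian (fun=> 1)) big1 // => j _; rewrite subrr mulr0.
  by rewrite laplacian_sym mulrC; congr (_ * _); rewrite mxE.
by apply/rV0Pn; exists (Ordinal n_gt0); rewrite mxE oner_eq0.
Qed.

Lemma trace_laplacian : \tr L = 2 * (num_edges G)%:R.
Proof.
rewrite -natrM -handshake natr_sum; apply: eq_bigr => i _.
by rewrite laplacianE eqxx adj_irr subr0.
Qed.

Lemma trace_laplacian_sqr :
  \tr (L *m L) = (zagreb1 G)%:R + 2 * (num_edges G)%:R.
Proof.
rewrite -natrM -handshake /zagreb1 !natr_sum -big_split.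
apply: eq_bigr => i _ /=; rewrite mxE (bigD1 i) //=.
rewrite laplacianE eqxx adj_irr subr0 mulr1n natrX expr2; congr (_ + _).
rewrite deg_sum natr_sum [RHS](bigD1 i) //= adj_irr add0r.
apply: eq_bigr => j j_neq_i.
rewrite (laplacian_sym j i) laplacianE eq_sym (negPf j_neq_i) sub0r mulrNN.
by rewrite -natrM mulnb andbb.
Qed.

(** The least eigenvalue is nonnegative since L is positive semidefinite, and
nonpositive since it is below the eigenvalue 0. *)
Lemma laplacian_spectrum_last s a : (0 < n)%N ->
    char_poly L = \prod_(x <- rcons s a) ('X - x%:P) ->
    sorted >=%R (rcons s a) ->
  a = 0.
Proof.
move=> n_gt0 charL sorted_s.
have eigenE x : eigenvalue L x = (x \in rcons s a).
  by rewrite eigenvalue_root_char charL root_prod_XsubC.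
apply/le_anti/andP; split; last first.
  by apply: laplacian_eigenvalue_ge0; rewrite eigenE mem_rcons mem_head.
have := laplacian_eigenvalue0 n_gt0; rewrite eigenE mem_rcons inE.
case/predU1P=> [<- // | s0]; move: sorted_s.
rewrite (sorted_pairwise ge_trans) pairwise_rcons => /andP[/allP/(_ _ s0)].
by [].
Qed.

End Laplacian.

(** * Popoviciu's inequality *)

Section ScaledVariance.

Variable R : realFieldType.
Implicit Types (s : seq R) (a b : R).

(** The square of the length times the variance of the entries of [s]. *)
Definition scaled_variance s : R :=
  (size s)%:R * (\sum_(x <- s) x ^+ 2) - (\sum_(x <- s) x) ^+ 2.

Lemma sum_quadratic s (u v w : R) :
  \sum_(x <- s) (u * x ^+ 2 + v * x + w)
  = u * (\sum_(x <- s) x ^+ 2) + v * (\sum_(x <- s) x) + (size s)%:R * w.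
Proof.
rewrite !big_split /= -!mulr_sumr; congr (_ + _).
by rewrite big_const_seq count_predT iter_addr_0 mulr_natl.
Qed.

(** With N entries of sum S, the squares (N x - S)^2 add up to N times the
scaled variance. *)
Lemma scaled_variance_ge0 s : 0 <= scaled_variance s.
Proof.
rewrite /scaled_variance; have [->|s_neq0] := eqVneq s [::].
  by rewrite !big_nil mulr0 expr0n subrr.
set N := (size s)%:R; set S := \sum_(x <- s) x.
have N_gt0 : 0 < N by rewrite ltr0n lt0n size_eq0.
have : 0 <= \sum_(x <- s) (N ^+ 2 * x ^+ 2 + (- 2 * N * S) * x + S ^+ 2).
  apply: sumr_ge0 => x _.
  have -> : N ^+ 2 * x ^+ 2 + - 2 * N * S * x + S ^+ 2 = (N * x - S) ^+ 2.
    by ring.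
  exact: sqr_ge0.
rewrite sum_quadratic -/N -/S => sum_ge0.
rewrite -(pmulr_rge0 _ N_gt0); apply: le_trans sum_ge0 _.
by rewrite le_eqVlt; apply/orP; left; apply/eqP; ring.
Qed.

(** Summing (b - x)(x - a) >= 0 over the entries bounds N Q - S^2 by
(N b - S)(S - N a), a product of two numbers with sum N (b - a). *)
Lemma scaled_variance_le s a b : {in s, forall x, a <= x <= b} ->
  4 * scaled_variance s <= ((size s)%:R * (b - a)) ^+ 2.
Proof.
move=> s_ab; rewrite /scaled_variance.
set N := (size s)%:R; set S := \sum_(x <- s) x.
set Q := \sum_(x <- s) x ^+ 2.
have : 0 <= \sum_(x <- s) (- 1 * x ^+ 2 + (a + b) * x + - (a * b)).
  rewrite big_seq; apply: sumr_ge0 => x /s_ab /andP[ax xb].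
  have -> : - 1 * x ^+ 2 + (a + b) * x + - (a * b) = (b - x) * (x - a) by ring.
  by rewrite mulr_ge0 ?subr_ge0.
rewrite sum_quadratic -/N -/S -/Q => /(mulr_ge0 (ler0n R (size s))).
rewrite -/N => sum_ge0.
rewrite -subr_ge0.
have -> : (N * (b - a)) ^+ 2 - 4 * (N * Q - S ^+ 2)
          = (N * (a + b) - 2 * S) ^+ 2
            + 4 * (N * (-1 * Q + (a + b) * S + N * - (a * b))) by ring.
by apply: addr_ge0; [exact: sqr_ge0 | rewrite mulr_ge0 ?ler0n].
Qed.

End ScaledVariance.

(** * Bound on the Laplacian spread *)

Lemma sorted_ge_bounds (R : realFieldType) (s : seq R) :
  sorted >=%R s -> {in s, forall x, s`_(size s).-1 <= x <= s`_0}.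
Proof.
move=> sorted_s x /(nthP 0)[i lt_i_s <-].
have s_gt0 : (0 < size s)%N by exact: leq_ltn_trans lt_i_s.
have ge_nth j k : (j <= k < size s)%N -> s`_k <= s`_j.
  case/andP=> le_j_k lt_k_s.
  apply: (sorted_leq_nth ge_trans lexx 0 sorted_s j k) => //.
  exact: leq_ltn_trans lt_k_s.
by rewrite !ge_nth ?lt_i_s // -ltnS prednK ?lt_i_s ?leqnn.
Qed.

Theorem theorem26 (R : realType) (n m : nat) (hn : (2 <= n)%N)
    (G : sgraph n) (hm : num_edges G = m)
    (mu : n.-tuple R) (hmu : ordered_spectrum (laplacian R G) mu)
    (phi : R) (hphi_ge : mu`_(n - 2) <= phi) (hphi_le : phi <= mu`_0) :
  2 / n%:R *
    Num.sqrt `| n%:R * (zagreb1 G)%:R + 2 * m%:R * n%:R + (n%:R - 1) * phi ^+ 2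
                - 4 * m%:R * (m%:R + phi) |
  <= laplacian_spread mu.
Proof.
  have n_gt0 : (0 < n)%N by exact: ltnW.
  move: hmu hphi_ge hphi_le; rewrite /ordered_spectrum /laplacian_spread.
  case: mu => mu size_mu /=.
  (* The last eigenvalue is split off, and phi takes its place. *)
  case/lastP: mu size_mu => [|s a] /eqP size_sa.
    by move: (n_gt0); rewrite -[n in (_ < n)%N]size_sa.
  case=> charL sorted_sa phi_ge phi_le.
  have a0 := laplacian_spectrum_last n_gt0 charL sorted_sa.
  have sumE := mxtrace_roots n_gt0 size_sa charL.
  have sum_sqrE := mxtrace_sqr_roots n_gt0 size_sa charL.
  rewrite trace_laplacian hm -cats1 big_cat big_seq1 a0 /= addr0 in sumE.
  rewrite trace_laplacian_sqr hm -cats1 big_cat big_seq1 a0 /= in sum_sqrE.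
  rewrite expr0n addr0 in sum_sqrE.
  have size_s : (size s).+1 = n by rewrite -size_sa size_rcons.
  have s_gt0 : (0 < size s)%N by rewrite -ltnS size_s.
  have last_s : (rcons s a)`_(n - 2) = s`_(size s).-1.
    by rewrite -[n in (n - 2)%N]size_s subSS subn1 nth_rcons prednK ?leqnn.
  have first_s : (rcons s a)`_0 = s`_0 by rewrite nth_rcons s_gt0.
  rewrite last_s in phi_ge *; rewrite first_s in phi_le *.
  have sorted_s : sorted >=%R s.
    by move: sorted_sa; rewrite -cats1 => /(cat_sorted2)[].
  have bounds : {in phi :: s, forall x, s`_(size s).-1 <= x <= s`_0}.
    move=> x; rewrite inE => /predU1P[-> | /sorted_ge_bounds-> //].
    by rewrite phi_ge.
  have -> : n%:R * (zagreb1 G)%:R + 2 * m%:R * n%:R + (n%:R - 1) * phi ^+ 2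
            - 4 * m%:R * (m%:R + phi) = scaled_variance (phi :: s).
    rewrite /scaled_variance !big_cons -sumE -sum_sqrE /= size_s; ring.
  have spread_ge0 : 0 <= s`_0 - s`_(size s).-1.
    by rewrite subr_ge0 (le_trans phi_ge).
  have := scaled_variance_le bounds; rewrite /= size_s.
  have n_gt0R : 0 < n%:R :> R by rewrite ltr0n.
  rewrite ger0_norm ?scaled_variance_ge0 // => variance_le.
  rewrite mulrAC ler_pdivrMr // [leRHS]mulrC.
  rewrite -(ler_pXn2r (ltn0Sn 1)) ?nnegrE ?mulr_ge0 ?sqrtr_ge0 ?ler0n //.
  by rewrite exprMn sqr_sqrtr ?scaled_variance_ge0 // -natrX.
Qed.
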